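(* For all types $t,u\in\{|\circ,\ +\circ\}$, given a homogeneous regular expression $\mathcal{A}$ of type $t$ of size $m$ and a homogeneous regular expression $\mathcal{B}$ of type $u$ of size $n$, one can decide whether $\mathcal{L}(\mathcal{A})\cap\mathcal{L}(\mathcal{B})\neq\emptyset$ in $\mathcal{O}(m+n)$ time.
   Context: Regular expressions are over an integer alphabet $\Sigma$ of size polynomial in the input size, viewed as rooted trees with letters at leaves; the size is the number of leaves. A homogeneous regexp of type $|\circ$ is a union $[T_1|\cdots|T_h]$ of nonempty strings (its language is $\{T_1,\dots,T_h\}$); one of type $+\circ$ is $[T]^+$ for a nonempty string $T$, whose language is $\{T^k:k\ge1\}$. *)

(* Defs.v *)
(* Plain MathComp; no real numbers are involved. *)
From mathcomp Require Import all_boot.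

Set Implicit Arguments.
Unset Strict Implicit.
Unset Printing Implicit Defensive.

(** * Regular expressions *)

(* Letters are natural numbers; the alphabet of size sigma is {0,...,sigma-1}. *)
Inductive regexp : Type :=
| Letter of nat
| Concat of seq regexp
| Union of seq regexp
| Plus of regexp
| Star of regexp.

(* The letters at the leaves of the tree, from left to right. *)
Fixpoint leaves (e : regexp) : seq nat :=
  match e with
  | Letter a => [:: a]
  | Concat s | Union s => flatten (map leaves s)
  | Plus e | Star e => leaves e
  end.

Definition rsize (e : regexp) : nat := size (leaves e).

Definition over_alphabet (sigma : nat) (e : regexp) : bool :=
  all (fun a => a < sigma) (leaves e).

Definition language := seq nat -> Prop.

Definition lcat (L1 L2 : language) : language :=
  fun x => exists y z, [/\ x = y ++ z, L1 y & L2 z].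

Definition lpow (L : language) (k : nat) : language :=
  iter k (lcat L) (fun x => x = [::]).

Fixpoint lang (e : regexp) : language :=
  match e with
  | Letter a => fun x => x = [:: a]
  | Concat s => foldr (fun e' => lcat (lang e')) (fun x => x = [::]) s
  | Union s => fun x => foldr (fun e' Q => lang e' x \/ Q) False s
  | Plus e' => fun x => exists2 k, 0 < k & lpow (lang e') k x
  | Star e' => fun x => exists k, lpow (lang e') k x
  end.

(** * Homogeneous expressions of types "|o" and "+o" *)

Inductive htype : Type := UnionConcat | PlusConcat.

Definition rstring (T : seq nat) : regexp := Concat (map Letter T).

Definition homogeneous (t : htype) (e : regexp) : Prop :=
  match t with
  | UnionConcat => exists Ts : seq (seq nat),
      [/\ Ts != [::], all (fun T => T != [::]) Ts & e = Union (map rstring Ts)]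
  | PlusConcat => exists2 T : seq nat, T != [::] & e = Plus (rstring T)
  end.

Lemma lang_rstring (T x : seq nat) : lang (rstring T) x <-> x = T.
Proof.
rewrite /rstring /=; elim: T x => [//|a T IH] x /=; split.
  by case=> y [z [-> -> /IH ->]].
by move=> ->; exists [:: a], T; split=> //; apply/IH.
Qed.

Lemma lang_union_rstring (Ts : seq (seq nat)) (x : seq nat) :
  lang (Union (map rstring Ts)) x <-> x \in Ts.
Proof.
elim: Ts => [//|T Ts IH]; rewrite inE; split.
  by case=> [/lang_rstring ->|/IH ->]; rewrite ?eqxx ?orbT.
by case/orP=> [/eqP ->|/IH]; [left; apply/lang_rstring | right].
Qed.

Lemma lang_plus_rstring (T x : seq nat) :
  lang (Plus (rstring T)) x <-> exists2 k, 0 < k & x = flatten (nseq k T).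
Proof.
have E k : forall y, lpow (lang (rstring T)) k y <-> y = flatten (nseq k T).
  elim: k => [//|k IH] y; split.
    by case=> y1 [y2 [-> /lang_rstring -> /IH ->]].
  move=> ->; exists T, (flatten (nseq k T)); split=> //.
    by apply/lang_rstring.
  by apply/IH.
by split=> -[k k0 /E H]; exists k.
Qed.

(** * The word RAM *)

(* Unit-cost word RAM with words of w bits: registers and memory cells hold
   numbers below 2 ^ w, so memory addresses are below 2 ^ w as well, and all
   arithmetic is modulo 2 ^ w.  A program is a fixed finite list of
   instructions, hence names finitely many registers. *)

Inductive binop : Type := OpAdd | OpSub | OpMul | OpDiv.

Inductive instr : Type :=
| Const of nat & nat               (* Const r k   : r := k               *)
| Arith of binop & nat & nat & nat (* Arith o r s t : r := s o t         *)
| Read of nat & nat                (* Read r s    : r := memory[s]       *)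
| Write of nat & nat               (* Write r s   : memory[r] := s       *)
| Jump of nat                      (* Jump l      : goto l               *)
| JumpEq of nat & nat & nat        (* JumpEq r s l : if r = s goto l     *)
| JumpLt of nat & nat & nat        (* JumpLt r s l : if r < s goto l     *)
| Halt of bool.                    (* Halt b      : stop with answer b   *)

Definition program := seq instr.

Record config : Type := Config {
  pc : nat;
  reg : nat -> nat;
  mem : nat -> nat
}.

Definition update (f : nat -> nat) (i v : nat) : nat -> nat :=
  fun j => if j == i then v else f j.

(* Subtraction wraps around; division by zero yields 0. *)
Definition eval_op (w : nat) (o : binop) (x y : nat) : nat :=
  match o with
  | OpAdd => (x + y) %% 2 ^ w
  | OpSub => (x + 2 ^ w - y) %% 2 ^ w
  | OpMul => (x * y) %% 2 ^ w
  | OpDiv => x %/ y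
  end.

Definition exec (w : nat) (i : instr) (c : config) : config :=
  let: Config p R M := c in
  match i with
  | Const r k => Config p.+1 (update R r (k %% 2 ^ w)) M
  | Arith o r s t => Config p.+1 (update R r (eval_op w o (R s) (R t))) M
  | Read r s => Config p.+1 (update R r (M (R s))) M
  | Write r s => Config p.+1 R (update M (R r) (R s))
  | Jump l => Config l R M
  | JumpEq r s l => Config (if R r == R s then l else p.+1) R M
  | JumpLt r s l => Config (if R r < R s then l else p.+1) R M
  | Halt _ => c
  end.

(* [run w P k c] is [Some b] when P, started in c, executes a [Halt b] among
   its first k instructions, and [None] when it does not halt within k steps
   or leaves the program. *)
Fixpoint run (w : nat) (P : program) (k : nat) (c : config) : option bool :=
  if k is k'.+1 then
    match onth P (pc c) with
    | None => None
    | Some (Halt b) => Some b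
    | Some i => run w P k' (exec w i c)
    end
  else None.

(* Initially the input occupies the memory cells 0, 1, 2, ...; all the other
   cells and all the registers are zero. *)
Definition init (w : nat) (input : seq nat) : config :=
  Config 0 (fun=> 0) (fun i => nth 0 input i %% 2 ^ w).

(* Preorder listing of the tree: a tag for each node, followed by the letter at
   a leaf and by the number of children at a concatenation or union node. *)
Fixpoint encode (e : regexp) : seq nat :=
  match e with
  | Letter a => [:: 0; a]
  | Concat s => [:: 1, size s & flatten (map encode s)]
  | Union s => [:: 2, size s & flatten (map encode s)]
  | Plus e' => 3 :: encode e'
  | Star e' => 4 :: encode e'
  end.

(* Main.v *)
Require Import Defs.
From mathcomp Require Import all_boot.
From mathcomp Require Import zify.

(* Two unions.  The words of A are inserted in a trie and those of B looked up.
   Since fresh memory is zero, the trie needs no initialisation: the child of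
   node x by letter a is stored at address 2 ^ w - ((x + a) ^ 2 + a), which lies
   beyond the input because letters are polynomially bounded.  A node is named by
   the input address of the letter that created it, and the tag cell found there,
   which holds 0, serves as the mark of inserted words.

   A union and [T]^+.  A word U is a power of T iff |T| divides |U| and
   U[k] = T[k mod |T|] for all k < |U|.

   [S]^+ and [T]^+.  The languages meet iff S[k mod |S|] = T[k mod |T|] for all
   k < |S| + |T|: this makes S T = T S, hence S^|T| = T^|S|. *)

Set Implicit Arguments.
Unset Strict Implicit.
Unset Printing Implicit Defensive.

(** * Powers of words *)

Definition power (k : nat) (T : seq nat) : seq nat := flatten (nseq k T).

Lemma size_power k T : size (power k T) = k * size T.
Proof. by elim: k => // k IH; rewrite /= size_cat IH mulSn. Qed.

Lemma nth_power k T i :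
  i < k * size T -> nth 0 (power k T) i = nth 0 T (i %% size T).
Proof.
elim: k i => [//|k IH] i; rewrite mulSn /power /= nth_cat => ik.
case: ltnP => [iT|Ti]; first by rewrite modn_small.
by rewrite IH -1?[in RHS](subnK Ti) ?modnDr //; lia.
Qed.

Lemma powerM j k T : power j (power k T) = power (j * k) T.
Proof.
elim: j => // j IH.
by rewrite mulSn [RHS]/power nseqD flatten_cat -/(power (j * k) T) -IH.
Qed.

(** For nonempty words, this compares letter [i] of the infinite periodic words S S S ... and T T T
    .... *)
Definition agree (S T : seq nat) (i : nat) : bool :=
  nth 0 S (i %% size S) == nth 0 T (i %% size T).

Lemma power_agree (U T : seq nat) : U != [::] ->
  (exists2 k, 0 < k & U = power k T) <->
  (size T %| size U) && all (agree U T) (iota 0 (size U)).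
Proof.
move=> U0; split.
  case=> k _ UE; rewrite {1}UE size_power dvdn_mull //=.
  apply/allP => i; rewrite mem_iota add0n => /andP[_ iU].
  by rewrite /agree modn_small // {1}UE nth_power // -size_power -UE.
case/andP=> /dvdnP[k kE] /allP ag; exists k.
  (* The exponent 0 would make [U] empty. *)
  by rewrite lt0n; apply: contraNneq U0 => k0; rewrite -size_eq0 kE k0.
apply: (@eq_from_nth _ 0) => [|i iU]; first by rewrite size_power.
rewrite nth_power -?kE // -[in LHS](modn_small iU).
by apply/eqP/ag; rewrite mem_iota.
Qed.

(* Both sides are the common prefix of length [size S + size T] of the periodic
   words S S S ... and T T T ... *)
Lemma agree_comm (S T : seq nat) :
  all (agree S T) (iota 0 (size S + size T)) -> S ++ T = T ++ S.
Proof.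
move=> /allP ag.
have ag' i : i < size S + size T ->
    nth 0 S (i %% size S) = nth 0 T (i %% size T).
  by move=> ilt; apply/eqP/ag; rewrite mem_iota.
apply: (@eq_from_nth _ 0) => [|i]; first by rewrite !size_cat addnC.
rewrite size_cat => ilt; transitivity (nth 0 S (i %% size S)).
  rewrite nth_cat; case: ltnP => iS; first by rewrite modn_small.
  rewrite -[in RHS](subnK iS) modnDr ag' ?modn_small //; lia.
rewrite nth_cat; case: ltnP => iT; first by rewrite ag' // modn_small.
rewrite ag' // -[in LHS](subnK iT) modnDr -ag' ?modn_small //; lia.
Qed.

Lemma comm_power (j k : nat) (S T : seq nat) : S ++ T = T ++ S ->
  power j S ++ power k T = power k T ++ power j S.
Proof.
move=> ST.
have Sk : S ++ power k T = power k T ++ S.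
  by elim: k => [|k IH]; rewrite ?cats0 //= catA ST -!catA -IH.
by elim: j => [|j IH]; rewrite ?cats0 //= -catA IH !catA Sk.
Qed.

Lemma powers_meet_agree (S T : seq nat) : S != [::] -> T != [::] ->
  (exists x, (exists2 j, 0 < j & x = power j S) /\
             (exists2 k, 0 < k & x = power k T)) <->
  all (agree S T) (iota 0 (size S + size T)).
Proof.
rewrite -!size_eq0 -!lt0n => S0 T0; split.
  case=> x [[j j0 xS] [k k0 xT]]; apply/allP => i.
  rewrite mem_iota add0n => /andP[_ ilt]; rewrite /agree.
  (* The common word [x] may be shorter than [N], but its [N]-th power is long enough and is still a
     power of both words. *)
  pose N := size S + size T.
  rewrite -(@nth_power (N * j)) -?(@nth_power (N * k)) -?powerM -?xS -?xT //.
    by apply: leq_trans ilt _; rewrite -mulnA leq_pmulr // muln_gt0 k0.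
  by apply: leq_trans ilt _; rewrite -mulnA leq_pmulr // muln_gt0 j0.
(* The powers S^|T| and T^|S| commute and have the same length, so comparing the prefixes of the two
   products shows that they are equal. *)
move=> /agree_comm /(comm_power (size T) (size S)) /eqP.
rewrite eqseq_cat ?size_power 1?mulnC // => /andP[/eqP E _].
exists (power (size T) S); split; first by exists (size T).
by exists (size S).
Qed.

Definition common_power (S T : seq nat) : bool :=
  all (agree S T) (iota 0 (size S + size T)).

Definition some_power (Us : seq (seq nat)) (T : seq nat) : bool :=
  has (fun U => (size T %| size U) && all (agree U T) (iota 0 (size U))) Us.

(** * Encoding of the input *)

Fixpoint letter_cells (T : seq nat) : seq nat :=
  if T is a :: T' then [:: 0, a & letter_cells T'] else [::].

Definition word_cells (T : seq nat) : seq nat := [:: 1, size T & letter_cells T].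

Definition words_cells (Ts : seq (seq nat)) : seq nat :=
  flatten (map word_cells Ts).

Definition string_cells (T : seq nat) : seq nat := 3 :: word_cells T.

Lemma encode_rstring T : encode (rstring T) = word_cells T.
Proof.
rewrite /word_cells /= size_map; congr [:: _, _ & _].
by elim: T => //= a T ->.
Qed.

Lemma encode_union Ts :
  encode (Union (map rstring Ts)) = [:: 2, size Ts & words_cells Ts].
Proof.
rewrite /= size_map /words_cells -map_comp; congr [:: _, _ & flatten _].
by apply: eq_map => T; apply: encode_rstring.
Qed.

Lemma leaves_rstring T : leaves (rstring T) = T.
Proof. by rewrite /=; elim: T => //= a T ->. Qed.

Lemma leaves_union Ts : leaves (Union (map rstring Ts)) = flatten Ts.
Proof.
rewrite /= -map_comp; congr flatten; rewrite -[RHS]map_id.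
by apply: eq_map => T; apply: leaves_rstring.
Qed.

Lemma size_letter_cells T : size (letter_cells T) = 2 * size T.
Proof. by elim: T => //= a T ->; lia. Qed.

Lemma nth_letter_cells T i : nth 0 (letter_cells T) (2 * i).+1 = nth 0 T i.
Proof. by elim: T i => [|a T IH] [|i] //=; rewrite -IH; congr nth; lia. Qed.

Lemma words_cells_cons T Ts :
  words_cells (T :: Ts) = word_cells T ++ words_cells Ts.
Proof. by []. Qed.

Lemma size_word_cells T : size (word_cells T) = 2 * size T + 2.
Proof. by rewrite /= size_letter_cells addn2. Qed.

Lemma size_words_cells Ts :
  size (words_cells Ts) = 2 * size (flatten Ts) + 2 * size Ts.
Proof.
elim: Ts => // T Ts IH.
by rewrite words_cells_cons [flatten _]/= !size_cat size_word_cells IH /=; lia.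
Qed.

Definition holds (M : nat -> nat) (p : nat) (s : seq nat) : Prop :=
  forall i, i < size s -> M (p + i) = nth 0 s i.

Lemma holds_cons M p a s : holds M p (a :: s) <-> M p = a /\ holds M p.+1 s.
Proof.
split=> [H|[H1 H2] [|i]]; last by rewrite addnS -addSn => /H2.
  split; first by have := H 0 isT; rewrite addn0.
  by move=> i ilt; have := H i.+1 ilt; rewrite addnS -addSn.
by rewrite addn0.
Qed.

Lemma holds_cat M p s1 s2 :
  holds M p (s1 ++ s2) <-> holds M p s1 /\ holds M (p + size s1) s2.
Proof.
elim: s1 p => [|a s1 IH] p /=; first by rewrite addn0; split=> [|[]].
by rewrite !holds_cons IH addnS addSn; tauto.
Qed.

(** Here [s] is the address of the first letter; the stride is 2 because a leaf tag precedes every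
    letter. *)
Definition holds_word (M : nat -> nat) (s : nat) (T : seq nat) : Prop :=
  forall i, i < size T -> M (s + 2 * i) = nth 0 T i.

(** The concatenation tag, the length and the first leaf tag precede the first letter, hence the
    offset 3. *)
Lemma holds_word_cells M p T : holds M p (word_cells T) ->
  M p.+1 = size T /\ holds_word M (p + 3) T.
Proof.
move=> /holds_cons[_ /holds_cons[-> H]]; split=> // i iT.
rewrite -nth_letter_cells -H ?size_letter_cells; [congr M|]; lia.
Qed.

(** * Symbolic execution *)

(** Registers are kept in a list, so that simplification computes their contents during symbolic
    execution. *)
Definition st (p : nat) (l : seq nat) (M : nat -> nat) : config :=
  Config p (nth 0 l) M.

Definition next (w : nat) (i : instr) (p : nat) (l : seq nat) (M : nat -> nat) :=
  match i with
  | Const r k => st p.+1 (set_nth 0 l r (k %% 2 ^ w)) M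
  | Arith o r s t =>
      st p.+1 (set_nth 0 l r (eval_op w o (nth 0 l s) (nth 0 l t))) M
  | Read r s => st p.+1 (set_nth 0 l r (M (nth 0 l s))) M
  | Write r s => st p.+1 l (update M (nth 0 l r) (nth 0 l s))
  | Jump q => st q l M
  | JumpEq r s q => st (if nth 0 l r == nth 0 l s then q else p.+1) l M
  | JumpLt r s q => st (if nth 0 l r < nth 0 l s then q else p.+1) l M
  | Halt _ => st p l M
  end.

(** Lists and functions of registers agree only pointwise, so runs have to be compared without
    functional extensionality. *)
Lemma run_ext w P k p R R' M :
  R =1 R' -> run w P k (Config p R M) = run w P k (Config p R' M).
Proof.
elim: k p R R' M => [//|k IH] p R R' M RR' /=.
have U r v : update R r v =1 update R' r v by move=> i; rewrite /update RR'.
by case: (onth P p) => // -[r n|o r s t|r s|r s|q|r s q|r s q|b] //=;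
  rewrite ?RR'; apply: IH.
Qed.

(** The budget is split in two: [k] is a numeral counting down along straight-line code, [K] is the
    symbolic budget of what follows. *)
Lemma run_step w P i p l M k K b : onth P p = Some i ->
  (if i is Halt b' then Some b' else run w P (k + K) (next w i p l M)) = b ->
  run w P (k.+1 + K) (st p l M) = b.
Proof.
rewrite addSn /= => -> <-.
by case: i => //= *; apply: run_ext => j; rewrite nth_set_nth.
Qed.

Lemma run_leq w P k k' c b :
  k <= k' -> run w P k c = Some b -> run w P k' c = Some b.
Proof.
elim: k k' c => [//|k IH] [//|k'] c /= kk'.
by case: (onth P (pc c)) => // -[] // *; apply: IH.
Qed.

Lemma eval_add w x y : x + y < 2 ^ w -> eval_op w OpAdd x y = x + y.
Proof. exact: modn_small. Qed.

Lemma eval_sub w x y : y <= x -> x < 2 ^ w -> eval_op w OpSub x y = x - y.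
Proof.
move=> yx xw; rewrite /= -addnBAC // modnDr modn_small //.
exact: leq_ltn_trans (leq_subr _ _) xw.
Qed.

Lemma eval_neg w y : 0 < y -> eval_op w OpSub 0 y = 2 ^ w - y.
Proof. by move=> y0; rewrite /= add0n modn_small // ltn_subrL y0 expn_gt0. Qed.

Lemma eval_mul w x y : x * y < 2 ^ w -> eval_op w OpMul x y = x * y.
Proof. exact: modn_small. Qed.

Definition start (n : nat) (M : nat -> nat) := st 0 (nseq n 0) M.

Arguments eval_op : simpl never.
Arguments run : simpl never.
Arguments st : simpl never.

Ltac step := apply: run_step; [reflexivity|rewrite /next /=].
Ltac step_const := step; rewrite modn_small; last lia.
Ltac step_add := step; rewrite eval_add; last lia.
Ltac step_sub := step; rewrite eval_sub; [|lia|lia].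

(** * Expressions of type +o *)

(* Registers: 0 and 1 hold the constants 0 and 1; 2 = p, the next word of the
   union; 3 = the number of words left there; 4, 5 = address and length of S;
   6, 7 = address and length of T; 8 = number of letters to compare; 9 = k.
   Jump targets: 16, 20 handle a union as B, as A; 24 walks over A to find B;
   36 takes the next word of the union as S; 49 compares S[k mod |S|] with
   T[k mod |T|].  When both expressions are of type +o, S is the word of B. *)
Definition plus_program : program := [::
  (* 0 *) Const 1 1; Read 10 0; Const 11 2; JumpEq 10 11 20;
  Const 6 4; Read 7 11; Const 2 3; Arith OpAdd 2 2 7; Arith OpAdd 2 2 7;
  Read 10 2; JumpEq 10 11 16;
  Arith OpAdd 4 2 11; Read 5 4; Arith OpAdd 4 4 11; Arith OpAdd 8 5 7; Jump 49;
  (* 16 *) Arith OpAdd 2 2 1; Read 3 2; Arith OpAdd 2 2 1; Jump 36;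
  (* 20 *) Read 3 1; Const 2 2; Const 6 2; Arith OpAdd 10 3 0;
  (* 24 *) JumpEq 10 0 32; Arith OpSub 10 10 1; Arith OpAdd 6 6 1; Read 11 6;
  Arith OpAdd 6 6 1; Arith OpAdd 6 6 11; Arith OpAdd 6 6 11; Jump 24;
  (* 32 *) Const 11 2; Arith OpAdd 6 6 11; Read 7 6; Arith OpAdd 6 6 11;
  (* 36 *) JumpEq 3 0 66; Arith OpSub 3 3 1; Arith OpAdd 2 2 1; Read 5 2;
  Arith OpAdd 4 2 1; Arith OpAdd 2 4 5; Arith OpAdd 2 2 5; Arith OpAdd 4 4 1;
  Arith OpDiv 10 5 7; Arith OpMul 10 10 7; JumpLt 10 5 36;
  Arith OpAdd 8 5 0; Const 9 0;
  (* 49 *) JumpEq 9 8 65;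
  Arith OpDiv 10 9 5; Arith OpMul 10 10 5; Arith OpSub 10 9 10;
  Arith OpAdd 10 10 10; Arith OpAdd 10 10 4; Read 10 10;
  Arith OpDiv 11 9 7; Arith OpMul 11 11 7; Arith OpSub 11 9 11;
  Arith OpAdd 11 11 11; Arith OpAdd 11 11 6; Read 11 11;
  Arith OpAdd 9 9 1; JumpEq 10 11 49; Jump 36;
  (* 65 *) Halt true; Halt false].

Arguments plus_program : simpl never.

(** The RAM has no remainder instruction; remainders come from a quotient, a product and a
    difference. *)
Lemma divnE_rem k d : k - k %/ d * d = k %% d.
Proof. by rewrite {1}(divn_eq k d) addKn. Qed.

(* Loops are verified in continuation-passing style: the answer b obtained within
   K steps from the exit of the loop is a hypothesis. *)
Lemma run_compare w M b K p h s t S T k d x y :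
  0 < size S -> 0 < size T -> holds_word M s S -> holds_word M t T ->
  s + 2 * size S < 2 ^ w -> t + 2 * size T < 2 ^ w -> k + d < 2 ^ w ->
  (forall k' x' y', run w plus_program K
     (st 36 [:: 0; 1; p; h; s; size S; t; size T; k + d; k'; x'; y'] M) = Some b) ->
  run w plus_program (15 * d + 2 + K)
    (st 49 [:: 0; 1; p; h; s; size S; t; size T; k + d; k; x; y] M)
  = Some (all (agree S T) (iota k d) || b).
Proof.
move=> S0 T0 HS HT sS tT; elim: d k x y => [|d IH] k x y kd Hb.
  by step; rewrite addn0 eqxx; step.
have -> : 15 * d.+1 + 2 + K = 15 + (15 * d + 2 + K) by lia.
have kS := ltn_pmod k S0; have kT := ltn_pmod k T0.
step; rewrite ifN; last lia.
step; rewrite [eval_op _ _ _ _]/eval_op.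
step; rewrite eval_mul; last by have := leq_divM k (size S); lia.
step; rewrite eval_sub; [|exact: leq_divM|lia].
rewrite divnE_rem.
step_add; step_add.
step; rewrite addnn -mul2n [_ + s]addnC HS //.
step; rewrite [eval_op _ _ _ _]/eval_op.
step; rewrite eval_mul; last by have := leq_divM k (size T); lia.
step; rewrite eval_sub; [|exact: leq_divM|lia].
rewrite divnE_rem.
step_add; step_add.
step; rewrite addnn -mul2n [_ + t]addnC HT //.
step_add.
step; rewrite [agree S T k]/agree; case: eqP => _ /=.
  rewrite -[_ + d.+1]addSnnS addn1; apply: IH; first by lia.
  by rewrite addSnnS.
(* On a mismatch the conjunction is false and the jump to 36 leaves the loop; from there [b] is
   reached within [K] steps. *)
have -> : 0 + (15 * d + 2 + K) = 1 + (15 * d + 1 + K) by lia.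
step.
by apply: run_leq (Hb _ _ _); lia.
Qed.

Lemma run_words w M t T :
  0 < size T -> holds_word M t T -> t + 2 * size T < 2 ^ w -> 1 < 2 ^ w ->
  forall Us p s ls L k x y, all (fun U => 0 < size U) Us -> holds M p (words_cells Us) ->
  p + size (words_cells Us) + 1 < 2 ^ w ->
  run w plus_program (sumn [seq 15 * size U + 15 | U <- Us] + 2)
    (st 36 [:: 0; 1; p; size Us; s; ls; t; size T; L; k; x; y] M)
  = Some (has (fun U => (size T %| size U) && all (agree U T) (iota 0 (size U))) Us).
Proof.
move=> T0 HT tT w1; elim=> [|U Us IH] p s ls L k x y.
  by move=> _ _ _; rewrite -[_ + 2]/(2 + 0); step; step.
rewrite words_cells_cons => /andP[U0 Us0] /holds_cat[/holds_word_cells [Mp HU]].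
rewrite size_cat size_word_cells => HUs pw.
(* Eleven instructions fetch [U] and test divisibility, two prepare the comparison, and the
   comparison takes at most [15 * size U + 2]. *)
have -> : 15 * size U + 15 + sumn [seq 15 * size U + 15 | U <- Us] + 2 =
  11 + (4 + 15 * size U + (sumn [seq 15 * size U + 15 | U <- Us] + 2)) by lia.
have {}IH s' ls' L' k' x' y' := IH _ s' ls' L' k' x' y' Us0 HUs ltac:(lia).
rewrite [has _ _]/=.
have size_Us := size_words_cells Us.
step; step_sub; rewrite subn1.
step_add; rewrite addn1; step; rewrite Mp; step_add; step_add; step_add; step_add.
have -> : p.+1 + 1 + size U + size U = p + (2 * size U + 2) by lia.
have -> : p.+1 + 1 + 1 = p + 3 by lia.
step; rewrite [eval_op _ _ _ _]/eval_op.
step; rewrite eval_mul; last by have := leq_divM (size U) (size T); lia.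
(* Divisibility fails exactly when rounding |U| down to a multiple of |T| makes it smaller. *)
step; rewrite /dvdn; have := divn_eq (size U) (size T).
case: ltnP => le_U eq_U.
  have -> : (size U %% size T == 0) = false by lia.
  rewrite andFb orFb; apply: run_leq (IH _ _ _ _ _ _); lia.
have -> : size U %% size T == 0 by lia.
have -> : 0 + (4 + 15 * size U + (sumn [seq 15 * size U + 15 | U <- Us] + 2)) =
  2 + (15 * size U + 2 + (sumn [seq 15 * size U + 15 | U <- Us] + 2)) by lia.
step_add; rewrite addn0; step_const.
apply: (@run_compare w M _ _ _ _ _ _ _ _ 0) => //; lia.
Qed.

(** The encoding of a union does not record its total length, so the start of the next expression is
    found by hopping over the words, eight instructions for each. *)
Lemma run_walk w M :
  forall Ts p q h k y l, holds M q (words_cells Ts) ->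
  q + size (words_cells Ts) < 2 ^ w -> forall b K,
  (forall x' y', run w plus_program K
     (st 32 [:: 0; 1; p; h; 0; 0; q + size (words_cells Ts); l; 0; k; x'; y'] M) = Some b) ->
  run w plus_program (8 * size Ts + 1 + K)
    (st 24 [:: 0; 1; p; h; 0; 0; q; l; 0; k; size Ts; y] M) = Some b.
Proof.
elim=> [|T Ts IH] p q h k y l.
  by move=> _ _ b K Hb; step; rewrite -[q]addn0.
rewrite words_cells_cons => /holds_cat[/holds_word_cells [Mq _] Hq].
rewrite size_cat size_word_cells in Hq * => qw b K Hb.
have size_Ts := size_words_cells Ts.
have -> : 8 * size (T :: Ts) + 1 + K = 8 + (8 * size Ts + 1 + K) by rewrite /=; lia.
step; step_sub; rewrite subn1; step_add; rewrite [q + 1]addn1; step; rewrite Mq.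
step_add; step_add; step_add; step.
have -> : q.+1 + 1 + size T + size T = q + (2 * size T + 2) by lia.
by apply: IH => //; [lia | rewrite -addnA].
Qed.

Lemma run_plus_plus w M S T :
  let input := string_cells S ++ string_cells T in
  0 < size S -> 0 < size T -> holds M 0 input -> size input + 2 < 2 ^ w ->
  run w plus_program (15 * (size S + size T) + 20) (start 12 M)
  = Some (common_power T S).
Proof.
move=> input S0 T0 /holds_cat[/holds_cons[M0 /holds_word_cells[M2 HS]]].
rewrite size_cat /= !size_letter_cells.
move=> /holds_cons[Mq /holds_word_cells[Mq2 HT]] Mw.
have -> : 15 * (size S + size T) + 20 = 16 + (15 * (size T + size S) + 2 + 2) by lia.
rewrite /start; step_const; step; rewrite M0; step_const; step; step_const.
step; rewrite M2; step_const; step_add; step_add.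
have -> : 3 + size S + size S = 0 + (2 * size S).+3 by lia.
set q := 0 + _ in Mq Mq2 HT *.
step; rewrite Mq; step; step_add; rewrite [q + 2]addn2.
step; rewrite Mq2; step_add; step_add; step.
have -> : q.+2 + 2 = q.+1 + 3 by lia.
(* Register 3 is still 0, so a mismatch leads from 36 straight to [Halt false]: the exit answer is
   [false], within two steps. *)
rewrite -[common_power _ _]orbF.
apply: (@run_compare w M false 2 q 0 _ 4 T S 0 (size T + size S)) => //; lia.
Qed.

Lemma run_plus_union w M T Us :
  let input := string_cells T ++ [:: 2, size Us & words_cells Us] in
  0 < size T -> all (fun U => 0 < size U) Us ->
  holds M 0 input -> size input + 2 < 2 ^ w ->
  run w plus_program (sumn [seq 15 * size U + 15 | U <- Us] + 17) (start 12 M)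
  = Some (some_power Us T).
Proof.
move=> input T0 U0 /holds_cat[/holds_cons[M0 /holds_word_cells[M2 HT]]].
rewrite size_cat /= !size_letter_cells.
move=> /holds_cons[Mq /holds_cons[Mq1 HUs]] Mw.
have -> : sumn [seq 15 * size U + 15 | U <- Us] + 17 =
  15 + (sumn [seq 15 * size U + 15 | U <- Us] + 2) by lia.
rewrite /start; step_const; step; rewrite M0; step_const; step; step_const.
step; rewrite M2; step_const; step_add; step_add.
have -> : 3 + size T + size T = 0 + (2 * size T).+3 by lia.
set q := 0 + _ in Mq Mq1 HUs *.
step; rewrite Mq; step; step_add; rewrite [q + 1]addn1.
step; rewrite Mq1; step_add; rewrite [q.+1 + 1]addn1; step.
by apply: run_words => //; lia.
Qed.

Lemma run_union_plus w M T Us :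
  let input := [:: 2, size Us & words_cells Us] ++ string_cells T in
  0 < size T -> all (fun U => 0 < size U) Us ->
  holds M 0 input -> size input + 2 < 2 ^ w ->
  run w plus_program
    (8 * size Us + sumn [seq 15 * size U + 15 | U <- Us] + 17) (start 12 M)
  = Some (some_power Us T).
Proof.
move=> input T0 U0 /holds_cat[/holds_cons[M0 /holds_cons[M1 HUs]]].
rewrite size_cat /= size_letter_cells.
move=> /holds_cons[_ /holds_word_cells[Mq HT]] Mw.
have size_Us := size_words_cells Us.
have -> : 8 * size Us + sumn [seq 15 * size U + 15 | U <- Us] + 17 =
  8 + (8 * size Us + 1 + (4 + (sumn [seq 15 * size U + 15 | U <- Us] + 4))) by lia.
rewrite /start; step_const; step; rewrite M0; step_const; step; step.
rewrite M1; step_const; step_const; step_add; rewrite addn0.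
apply: run_walk => // [|x y]; first by lia.
step_const; step_add; rewrite [_ + 2]addn2; step; rewrite Mq; step_add.
have -> : (2 + size (words_cells Us)).+2 + 2 = (2 + size (words_cells Us)).+1 + 3 by lia.
apply: (@run_leq _ _ (sumn [seq 15 * size U + 15 | U <- Us] + 2)); first by lia.
by apply: run_words => //; lia.
Qed.

(** * Two unions *)

(* Registers: 0 and 1 hold the constants 0 and 1; 2 = input pointer; 3 = words
   left; 4 = phase (0 inserts the words of A, 1 looks up those of B);
   5 = letters left; 6 = current node; 7 = letter; 8 = address; 9 = mark.
   Jump targets: 1 enters an expression, 4 a word, 10 a letter; 25 ends a word,
   32 an expression. *)
Definition trie_program : program := [::
  (* 0 *) Const 1 1;
  (* 1 *) Arith OpAdd 2 2 1; Read 3 2; Arith OpAdd 2 2 1;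
  (* 4 *) JumpEq 3 0 32; Arith OpSub 3 3 1; Arith OpAdd 2 2 1; Read 5 2;
  Arith OpAdd 2 2 1; Const 6 1;
  (* 10 *) JumpEq 5 0 25; Arith OpAdd 8 2 1; Read 7 8;
  Arith OpAdd 8 6 7; Arith OpMul 8 8 8; Arith OpAdd 8 8 7; Arith OpSub 8 0 8;
  Read 6 8; JumpLt 0 6 21; Write 8 2; Arith OpAdd 6 2 0;
  (* 21 *) Arith OpAdd 2 2 1; Arith OpAdd 2 2 1; Arith OpSub 5 5 1; Jump 10;
  (* 25 *) JumpEq 4 1 28; Write 6 1; Jump 4;
  (* 28 *) Read 9 6; JumpEq 9 1 31; Jump 4; Halt true;
  (* 32 *) JumpEq 4 1 35; Arith OpAdd 4 4 1; Jump 1; Halt false].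

Arguments trie_program : simpl never.

(** * Addresses of children and abstract tries *)

Definition slot (x a : nat) : nat := (x + a) * (x + a) + a.

(** The value [slot x a] lies between the square of [x + a] and the next square, so it determines
    [x + a], and then [a]. *)
Lemma slot_inj x a y b : slot x a = slot y b -> x = y /\ a = b.
Proof. by rewrite /slot => E; have : x + a = y + b; nia. Qed.

Lemma leq_slot x a y b : x <= y -> a <= b -> slot x a <= slot y b.
Proof. by move=> xy ab; rewrite leq_add // leq_mul // leq_add. Qed.

(** The root is named 1, and 0 stands for a missing node. *)
Definition node (child : nat -> nat -> nat) (s : seq nat) : nat := foldl child 1 s.

Lemma node_rcons child s a : node child (rcons s a) = child (node child s) a.
Proof. by rewrite /node foldl_rcons. Qed.

(** All names are below [p], so [p] is fresh. The root is nobody's child, and every other node has a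
    unique parent and a unique incoming letter. *)
Definition trie (child : nat -> nat -> nat) (p : nat) : Prop :=
  forall x a, child x a != 0 ->
  [/\ 0 < x < p, 1 < child x a < p &
      forall y b, child y b = child x a -> y = x /\ b = a].

Lemma trie_child0 child p a : trie child p -> child 0 a = 0.
Proof. by move=> H; case: (eqVneq (child 0 a) 0) => // /H[]. Qed.

Lemma trie_fresh child p x a : trie child p -> p <= x -> child x a = 0.
Proof. by move=> H px; case: (eqVneq (child x a) 0) => // /H[]; lia. Qed.

Lemma trie_leq child p q : trie child p -> p <= q -> trie child q.
Proof. by move=> H pq x a /H[? ? ?]; split=> //; lia. Qed.

Lemma node_rcons_neq0 child p s a : trie child p ->
  node child (rcons s a) != 0 -> node child s != 0.
Proof.
move=> H; rewrite node_rcons; apply: contraNneq => ->.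
by rewrite (trie_child0 _ H).
Qed.

Lemma node_ltn child p s : trie child p -> 1 < p -> node child s < p.
Proof.
move=> H p1; case/lastP: s => [//|s a]; rewrite node_rcons.
by have [->|/H[]] := eqVneq (child (node child s) a) 0; lia.
Qed.

(** A node determines its last edge, and the root ends no edge; thus the word can be read back from
    its end. *)
Lemma node_inj child p s t : trie child p -> node child s != 0 ->
  node child s = node child t -> s = t.
Proof.
move=> H; elim/last_ind: s t => [|s a IH] t s0 E.
  case/lastP: t E => // t b; rewrite node_rcons => E.
  have /H[_] : child (node child t) b != 0 by rewrite -E.
  by rewrite -E.
have s0' := node_rcons_neq0 H s0.
case/lastP: t E => [|t b]; rewrite !node_rcons in s0 * => E.
  by have /H[] := s0; rewrite E.
have [_ _ inj] := H _ _ s0; have [Et ->] := inj _ _ (esym E).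
by rewrite (IH t).
Qed.

Definition extend (child : nat -> nat -> nat) (x a p : nat) : nat -> nat -> nat :=
  fun y b => if (y == x) && (b == a) then p else child y b.

Lemma trie_extend child p q x a :
  trie child p -> 1 < p < q -> 0 < x < p -> child x a = 0 ->
  trie (extend child x a p) q.
Proof.
move=> H pq xp xa0 y b; rewrite /extend.
case: ifP => [/andP[/eqP -> /eqP ->] _|yb].
  split; [lia|lia|] => z c; case: ifP => [/andP[/eqP -> /eqP ->] //|_ E].
  by have /H[] : child z c != 0; lia.
move=> yb0; have [? ? inj] := H _ _ yb0; split; [lia|lia|] => z c.
by case: ifP => [_|_ /inj //]; lia.
Qed.

Lemma node_extend child p x a s : trie child p -> 0 < x < p -> child x a = 0 ->
  node child s != 0 -> node (extend child x a p) s = node child s.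
Proof.
move=> H xp xa0; elim/last_ind: s => // s b IH sb0.
rewrite node_rcons IH ?(node_rcons_neq0 H sb0) // node_rcons /extend.
by case: ifP => // /andP[/eqP Ex /eqP Eb]; rewrite node_rcons Ex Eb xa0 in sb0.
Qed.

(** A word gains a node only by ending with the new edge: the fresh node [p] has no children, so
    longer words fall back to 0. *)
Lemma node_extend0 child p x a s : trie child p -> 0 < x < p -> child x a = 0 ->
  node child s = 0 ->
  node (extend child x a p) s = 0 \/ node (extend child x a p) s = p.
Proof.
move=> H xp xa0; elim/last_ind: s => // s b IH; rewrite !node_rcons => sb0.
have [s0|s0] := eqVneq (node child s) 0; last first.
  by rewrite !(node_extend H) // /extend; case: ifP; [right|left].
left; rewrite /extend; case: (IH s0) => ->.
  by rewrite ifN ?(trie_child0 _ H) //; lia.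
by rewrite ifN ?(trie_fresh _ H) //; lia.
Qed.

(* E is the size of the input, of which [rest], starting at p, is still to be
   read; the table of children lies at the top of the memory. *)
Record stores (w sigma E : nat) (child : nat -> nat -> nat)
    (W : seq (seq nat)) (p : nat) (rest : seq nat) (M : nat -> nat) : Prop := {
  st_trie : trie child p;
  st_gt1 : 1 < p;
  st_size : p + size rest = E;
  st_rest : holds M p rest;
  st_child : forall x a, x < E -> a < sigma -> M (2 ^ w - slot x a) = child x a;
  st_mark : forall s, s != [::] -> (M (node child s) == 1) = (s \in W);
  st_mem0 : M 0 != 1
}.

Lemma stores_cat w sigma E child W p r1 r2 M :
  stores w sigma E child W p (r1 ++ r2) M ->
  stores w sigma E child W (p + size r1) r2 M.
Proof.
case=> Ht p1 Es /holds_cat[_ Hr] Hc Hm M0; split=> //.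
- by apply: trie_leq Ht _; lia.
- by lia.
- by rewrite -Es size_cat addnA.
Qed.

(** The written cell lies beyond the input because [slot x a + E < 2 ^ w], so neither the unread
    input nor the marks change. *)
Lemma stores_insert w sigma E child W p a rest v M :
  slot E sigma + E < 2 ^ w -> a < sigma ->
  stores w sigma E child W p [:: 0, a & rest] M ->
  node child v != 0 -> child (node child v) a = 0 ->
  let x := node child v in
  stores w sigma E (extend child x a p) W p.+2 rest (update M (2 ^ w - slot x a) p)
  /\ node (extend child x a p) (rcons v a) = p.
Proof.
move=> sE ha [Ht p1 Es Hr Hc Hm M0] v0 va0 x.
have xp : 0 < x < p by rewrite lt0n v0 (node_ltn _ Ht).
have low y b : y < E -> b < sigma -> slot y b + E < 2 ^ w.
  by move=> yE bs; apply: leq_ltn_trans sE; rewrite leq_add2r leq_slot // ltnW.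
have /= Es' := Es; have xE : x < E by lia.
have lowx := low _ _ xE ha.
have updE i : i < E -> update M (2 ^ w - slot x a) p i = M i.
  by move=> iE; rewrite /update ifN //; lia.
have [Mp /holds_cons[_ Hr']] : M p = 0 /\ _ := proj1 (holds_cons _ _ _ _) Hr.
split; last by rewrite node_rcons (node_extend Ht) // /extend !eqxx.
split.
- by apply: trie_extend => //; lia.
- by lia.
- by lia.
- by move=> i ir; rewrite updE ?Hr' //; lia.
- move=> y b yE bs; rewrite /extend /update; have lowy := low _ _ yE bs.
  case: (ifP (_ && _)) => [/andP[/eqP -> /eqP ->]|yb]; first by rewrite eqxx.
  rewrite ifN ?Hc //; apply: contraFneq yb => eq_slot.
  (* Both slots are below [2 ^ w], so the subtractions are not truncated and equal addresses give
     equal slots. *)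
  have /slot_inj[-> ->] : slot y b = slot x a by lia.
  by rewrite !eqxx.
- move=> s s0; have [ns0|ns0] := eqVneq (node child s) 0; last first.
    rewrite (node_extend Ht) // updE ?Hm //.
    by have := node_ltn s Ht p1; lia.
  (* Such a word is unmarked and stays so: it leads to 0, whose cell is not 1, or to [p], whose cell
     holds the leaf tag 0. *)
  have <- := Hm s s0; rewrite ns0 (negbTE M0).
  case: (node_extend0 Ht xp va0 ns0) => ->; rewrite updE ?Mp //; [exact/negbTE|lia|lia].
- by rewrite updE //; lia.
Qed.

(** The overwritten cell is below [p], hence already read, and by [node_inj] no other word shares
    it. *)
Lemma stores_mark w sigma E child W p rest T M :
  slot E sigma + E < 2 ^ w ->
  stores w sigma E child W p rest M -> T != [::] -> node child T != 0 ->
  stores w sigma E child (T :: W) p rest (update M (node child T) 1).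
Proof.
move=> sE [Ht p1 Es Hr Hc Hm M0] T0 nT.
have nTp := node_ltn T Ht p1; split=> //.
- by move=> i ir; rewrite /update ifN ?Hr //; lia.
- move=> x a xE sa; rewrite /update ifN ?Hc //.
  by have := leq_slot (ltnW xE) (ltnW sa); lia.
- move=> s s0; rewrite /update inE -Hm //.
  have [sT|sT] := eqVneq (node child s) (node child T).
    by rewrite (node_inj Ht nT (esym sT)) !eqxx.
  suff -> : (s == T) = false by [].
  by apply: contraNF sT => /eqP ->.
- by rewrite /update ifN // eq_sym.
Qed.

(** * Correctness of the trie program *)

(** Here [v] is the prefix already read. Both phases share this descent: looking up a word may
    create nodes, but it marks none, so [W] is unchanged. *)
Lemma run_insert w sigma E W h ph rest b K :
  slot E sigma + E < 2 ^ w ->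
  forall s v child p M a ad mk,
  stores w sigma E child W p (letter_cells s ++ rest) M ->
  all (ltn^~ sigma) s -> node child v != 0 ->
  (forall child' M' a' ad',
     stores w sigma E child' W (p + 2 * size s) rest M' ->
     node child' (v ++ s) != 0 ->
     run w trie_program K
       (st 25 [:: 0; 1; p + 2 * size s; h; ph; 0; node child' (v ++ s); a'; ad'; mk] M')
     = Some b) ->
  run w trie_program (15 * size s + 1 + K)
    (st 10 [:: 0; 1; p; h; ph; size s; node child v; a; ad; mk] M) = Some b.
Proof.
move=> sE; elim=> [|a s IH] v child p M a0 ad mk HM.
  move=> _ v0 Hb; step; rewrite cats0 addn0 in Hb; exact: Hb.
case/andP=> /= sa ss v0 Hb.
have -> : 15 * size (a :: s) + 1 + K = 15 + (15 * size s + 1 + K) by rewrite /=; lia.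
have [Ht p1 /= Es /holds_cons[_ /holds_cons[Ma _]] Hc _ _] := HM.
rewrite size_cat size_letter_cells in Es.
have xp := node_ltn v Ht p1; set x := node child v in v0 xp *.
have /= slot_lt : slot x a <= slot E sigma by rewrite leq_slot //; [lia|exact: ltnW].
(* These bounds exclude overflow while the address is computed. *)
have sum_slot : x + a <= slot x a.
  by apply: leq_trans (leq_addr _ _); case: (x + a) => // z; rewrite leq_pmulr.
have square_slot : (x + a) * (x + a) <= slot x a by apply: leq_addr.
have slot0 : 0 < slot x a by lia.
(* The cases of an existing and of a new child meet again at instruction 21. *)
have continue y child' M' ad' :
    stores w sigma E child' W p.+2 (letter_cells s ++ rest) M' ->
    node child' (rcons v a) = y -> y != 0 ->
    run w trie_program (4 + (15 * size s + 1 + K))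
      (st 21 [:: 0; 1; p; h; ph; (size s).+1; y; a; ad'; mk] M') = Some b.
  move=> HM' <- v'0; step_add; step_add; step_sub; step.
  rewrite subn1 -[p + 1 + 1]addnA addn2; apply: IH HM' ss v'0 _ => child'' M'' a'' ad''.
  have -> : p.+2 + 2 * size s = p + 2 * (size s).+1 by lia.
  by rewrite cat_rcons; apply: Hb.
step; step_add; step; rewrite [p + 1]addn1 Ma.
step; rewrite eval_add; last by lia.
step; rewrite eval_mul; last by lia.
step; rewrite eval_add; last by rewrite -/(slot x a); lia.
rewrite -/(slot x a).
step; rewrite eval_neg //.
step; rewrite Hc //; last by lia.
step; case: posnP => va0; last first.
  have HM' : stores w sigma E child W p.+2 (letter_cells s ++ rest) M.
    by rewrite -[p.+2]addn2; apply: (stores_cat (r1 := [:: 0; a])) HM.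
  apply: run_leq (continue (child x a) child M _ HM' _ _); first by lia.
    by rewrite node_rcons.
  by rewrite -lt0n.
have [HM' nM'] := stores_insert sE sa HM v0 va0.
step; step_add; rewrite addn0.
by apply: run_leq (continue p _ _ _ HM' nM' _); lia.
Qed.

(** Marking conses words in reverse order, so [W'] is described only up to membership. *)
Lemma run_insert_words w sigma E rest b K :
  slot E sigma + E < 2 ^ w -> 1 < 2 ^ w ->
  forall Ts W child p M len x a ad mk,
  all (fun T => 0 < size T) Ts -> all (ltn^~ sigma) (flatten Ts) ->
  stores w sigma E child W p (words_cells Ts ++ rest) M ->
  (forall child' M' W' len' x' a' ad',
     stores w sigma E child' W' (p + size (words_cells Ts)) rest M' ->
     W' =i W ++ Ts ->
     run w trie_program K
       (st 32 [:: 0; 1; p + size (words_cells Ts); 0; 0; len'; x'; a'; ad'; mk] M')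
     = Some b) ->
  run w trie_program (sumn [seq 15 * size T + 10 | T <- Ts] + 1 + K)
    (st 4 [:: 0; 1; p; size Ts; 0; len; x; a; ad; mk] M) = Some b.
Proof.
move=> sE w1; elim=> [|T Ts IH] W child p M len x a ad mk.
  move=> _ _ HM Hb; rewrite addn0 in Hb; step; apply: Hb HM _.
  by move=> s; rewrite cats0.
case/andP=> T0 Ts0; rewrite [flatten _]/= all_cat => /andP[Tsig Tssig] HM Hb.
have -> : sumn [seq 15 * size T + 10 | T <- T :: Ts] + 1 + K =
  6 + (15 * size T + 1 + (3 + (sumn [seq 15 * size T + 10 | T <- Ts] + 1 + K))).
  by rewrite /=; lia.
rewrite words_cells_cons -catA in HM.
have [_ p1 Es Hp _ _ _] := HM.
have size_Ts := size_words_cells Ts.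
rewrite !size_cat size_word_cells in Es.
move/holds_cons: Hp => [_ /holds_cons[Mp _]].
have Ew : E < 2 ^ w by apply: leq_ltn_trans sE; apply: leq_addl.
step; step_sub; rewrite subn1; step_add; rewrite [p + 1]addn1; step; rewrite Mp.
step_add; rewrite [p.+1 + 1]addn1; step_const.
apply: (@run_insert w sigma E W (size Ts) 0 (words_cells Ts ++ rest) b _ sE
   T [::] child p.+2) => //.
  by rewrite -[p.+2]addn2; apply: (stores_cat (r1 := [:: 1; size T])) HM.
rewrite /= => child' M' a' ad' HM' nT.
have T_neq : T != [::] by rewrite -size_eq0 -lt0n.
step; step; step.
apply: IH (stores_mark sE HM' T_neq nT) _ => //.
have -> : p.+2 + 2 * size T + size (words_cells Ts) = p + size (words_cells (T :: Ts)).
  by rewrite words_cells_cons size_cat size_word_cells; lia.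
move=> child'' M'' W' len' x' a'' ad'' HM'' EW; apply: Hb HM'' _ => s.
by rewrite EW !(inE, mem_cat) orbCA orbA.
Qed.

Lemma run_query_words w sigma E W rest :
  slot E sigma + E < 2 ^ w -> 1 < 2 ^ w ->
  forall Ts child p M len x a ad mk,
  all (fun T => 0 < size T) Ts -> all (ltn^~ sigma) (flatten Ts) ->
  stores w sigma E child W p (words_cells Ts ++ rest) M ->
  run w trie_program (sumn [seq 15 * size T + 11 | T <- Ts] + 3)
    (st 4 [:: 0; 1; p; size Ts; 1; len; x; a; ad; mk] M)
  = Some (has (mem W) Ts).
Proof.
move=> sE w1; elim=> [|T Ts IH] child p M len x a ad mk.
  by move=> _ _ HM; rewrite -[_ + 3]/(3 + 0); step; step; step.
case/andP=> T0 Ts0; rewrite [flatten _]/= all_cat => /andP[Tsig Tssig] HM.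
have -> : sumn [seq 15 * size T + 11 | T <- T :: Ts] + 3 =
  6 + (15 * size T + 1 + (4 + (sumn [seq 15 * size T + 11 | T <- Ts] + 3))).
  by rewrite /=; lia.
rewrite words_cells_cons -catA in HM.
have [_ p1 Es Hp _ _ _] := HM.
have size_Ts := size_words_cells Ts.
rewrite !size_cat size_word_cells in Es.
move/holds_cons: Hp => [_ /holds_cons[Mp _]].
have Ew : E < 2 ^ w by apply: leq_ltn_trans sE; apply: leq_addl.
step; step_sub; rewrite subn1; step_add; rewrite [p + 1]addn1; step; rewrite Mp.
step_add; rewrite [p.+1 + 1]addn1; step_const.
apply: (@run_insert w sigma E W (size Ts) 1 (words_cells Ts ++ rest) _ _ sE
   T [::] child p.+2) => //.
  by rewrite -[p.+2]addn2; apply: (stores_cat (r1 := [:: 1; size T])) HM.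
rewrite /= => child' M' a' ad' HM' nT.
have T_neq : T != [::] by rewrite -size_eq0 -lt0n.
(* Nodes created during the lookup are unmarked, so the mark still tests membership in [W]. *)
step; step; step; rewrite (st_mark HM' T_neq).
case: (T \in W); first by rewrite -[_ + _]/(1 + (_ + 3)); step.
by step; apply: IH HM'.
Qed.

Lemma run_union_union w sigma M Ss Ts :
  let input := [:: 2, size Ss & words_cells Ss] ++ [:: 2, size Ts & words_cells Ts] in
  all (fun T => 0 < size T) Ss -> all (fun T => 0 < size T) Ts ->
  all (ltn^~ sigma) (flatten Ss) -> all (ltn^~ sigma) (flatten Ts) ->
  slot (size input) sigma + size input < 2 ^ w ->
  (forall i, M i = nth 0 input i) ->
  run w trie_program
    (sumn [seq 15 * size T + 10 | T <- Ss] + sumn [seq 15 * size T + 11 | T <- Ts] + 14)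
    (start 10 M) = Some (has (mem Ss) Ts).
Proof.
move=> input Ss0 Ts0 Ss_sigma Ts_sigma; set E := size input => sE HM.
have -> : sumn [seq 15 * size T + 10 | T <- Ss] + sumn [seq 15 * size T + 11 | T <- Ts] + 14
  = 4 + (sumn [seq 15 * size T + 10 | T <- Ss] + 1
         + (6 + (sumn [seq 15 * size T + 11 | T <- Ts] + 3))) by lia.
have EE : E = size (words_cells Ss) + size (words_cells Ts) + 4.
  by rewrite /E /input size_cat /=; lia.
rewrite /start; step_const; step_add; step; rewrite HM; step_add.
have HM2 : stores w sigma E (fun _ _ => 0) [::] 2
    (words_cells Ss ++ [:: 2, size Ts & words_cells Ts]) M.
  split; [by []|by []| | | | |].
  - by rewrite size_cat /=; lia.
  - by move=> i _; rewrite HM.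
  (* The table lies beyond the input, where fresh memory is zero: initially there are no
     children. *)
  - move=> x a xE sa; rewrite HM nth_default //.
    by have := leq_slot (ltnW xE) (ltnW sa); rewrite -/E; lia.
  (* Every nonempty word leads to 0, and cell 0 holds the union tag 2. *)
  - by move=> s; case/lastP: s => // s a _; rewrite node_rcons HM.
  - by rewrite HM.
have w1 : 1 < 2 ^ w by lia.
rewrite add0n -[0 + 1 + 1]/2.
apply: (run_insert_words sE w1 _ _ _ _ Ss0 Ss_sigma HM2) => child M' W len x a ad HM' EW.
set p := 2 + _ in HM' *; have [_ _ /= Es Hp _ _ _] := HM'.
move/holds_cons: Hp => [_ /holds_cons[Mp _]].
step; step_add; step; step_add; rewrite [p + 1]addn1; step; rewrite Mp; step_add.
rewrite (eq_has (a2 := mem W)) => [|T]; last by rewrite /= EW.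
apply: (@run_query_words w sigma E W [::]) => //.
rewrite cats0 addn1 -[p.+2]addn2.
by apply: (stores_cat (r1 := [:: 2; size Ts])) HM'.
Qed.

(** * Resource bounds and the decision procedure *)

Lemma run_init w P r input k K b :
  all (ltn^~ (2 ^ w)) input -> k <= K ->
  (forall M, (forall i, M i = nth 0 input i) -> run w P k (start r M) = Some b) ->
  run w P K (init w input) = Some b.
Proof.
move=> /allP in_w kK H; apply: run_leq kK _.
rewrite -(H (fun i => nth 0 input i %% 2 ^ w)) => [|i].
  by apply: run_ext => i; rewrite nth_nseq if_same.
have [iE|iE] := ltnP i (size input); first by rewrite modn_small //; apply/in_w/mem_nth.
by rewrite nth_default // mod0n.
Qed.

(** Nonempty words are at most as many as their letters, so a constant overhead per word stays
    linear. *)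
Lemma sum_sizes_leq a b (Ts : seq (seq nat)) : all (fun T => 0 < size T) Ts ->
  sumn [seq a * size T + b | T <- Ts] <= (a + b) * size (flatten Ts).
Proof.
elim: Ts => //= T Ts IH /andP[T0 /IH {}IH]; rewrite size_cat mulnDr leq_add //.
by rewrite mulnDl leq_add2l leq_pmulr.
Qed.

Lemma count_words_leq (Ts : seq (seq nat)) : all (fun T => 0 < size T) Ts ->
  size Ts <= size (flatten Ts).
Proof. by elim: Ts => //= T Ts IH /andP[T0 /IH {}IH]; rewrite size_cat; lia. Qed.

Lemma word_cells_bound B T : 1 < B -> size T < B -> all (ltn^~ B) T ->
  all (ltn^~ B) (word_cells T).
Proof.
move=> B1 TB T_B; rewrite /= B1 TB /=.
by elim: T T_B {TB} => //= a T IH /andP[-> /IH ->]; rewrite (ltnW B1).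
Qed.

Lemma words_cells_bound B Ts : 1 < B -> size (flatten Ts) < B ->
  all (ltn^~ B) (flatten Ts) -> all (ltn^~ B) (words_cells Ts).
Proof.
move=> B1; elim: Ts => // T Ts IH.
rewrite words_cells_cons [flatten _]/= size_cat !all_cat => sB /andP[TB TsB].
by rewrite word_cells_bound ?IH //; lia.
Qed.

(** With [y = N ^ (c + 4)] bounding both [E] and [sigma], the sum is at most 4y^2 + 2y < 8y^2, and 8
    <= N^3; this gives the exponent 2c + 11. *)
Lemma slot_bound c N sigma E w : 1 < N -> sigma <= N ^ c -> E <= 8 * N ->
  N ^ (2 * c + 11) <= 2 ^ w -> slot E sigma + E < 2 ^ w.
Proof.
move=> N1 sN EN; apply: leq_trans; set y := N ^ (c + 4).
have N0 := ltnW N1.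
have N3 : 8 <= N ^ 3 by rewrite -[8]/(2 ^ 3) leq_exp2r.
have y0 : 0 < y by rewrite expn_gt0 N0.
have sy : sigma <= y by apply: leq_trans sN _; rewrite leq_pexp2l ?leq_addr.
have Ey : E <= y.
  apply: leq_trans EN _; apply: (@leq_trans (N ^ 4)).
    by rewrite (expnS N 3) mulnC leq_mul.
  by rewrite leq_pexp2l ?leq_addl.
have -> : N ^ (2 * c + 11) = N ^ 3 * (y * y).
  by rewrite -!expnD; congr (_ ^ _); lia.
apply: (@leq_trans (8 * (y * y))); last by rewrite leq_mul2r N3 orbT.
by apply: leq_ltn_trans (leq_add (leq_slot Ey sy) Ey) _; rewrite /slot; nia.
Qed.

Lemma word_bounds c N sigma w E : 1 < N -> sigma <= N ^ c -> E + 2 <= 8 * N ->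
  N ^ (2 * c + 11) <= 2 ^ w ->
  [/\ slot E sigma + E < 2 ^ w, E + 2 < 2 ^ w & sigma <= 2 ^ w].
Proof.
move=> N1 sN EN Nw; have := slot_bound N1 sN EN Nw.
have := leq_slot (leq_addr 2 E) (leqnn sigma).
have : sigma <= slot E sigma by apply: leq_addl.
by split; lia.
Qed.

Lemma all_ltn_leq B B' T : B <= B' -> all (ltn^~ B) T -> all (ltn^~ B') T.
Proof. by move=> BB'; apply: sub_all => a /leq_trans; apply. Qed.

Lemma union_sizes (Ts : seq (seq nat)) :
  Ts != [::] -> all (fun T : seq nat => T != [::]) Ts ->
  [/\ all (fun T => 0 < size T) Ts, 0 < size (flatten Ts),
      size Ts <= size (flatten Ts) &
      size (words_cells Ts) = 2 * size (flatten Ts) + 2 * size Ts].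
Proof.
have -> : all (fun T : seq nat => T != [::]) Ts = all (fun T => 0 < size T) Ts.
  by apply: eq_all => T; rewrite -size_eq0 lt0n.
move=> Ts_neq Ts0; have count := count_words_leq Ts0.
split=> //; last exact: size_words_cells.
by apply: leq_trans count; rewrite lt0n size_eq0.
Qed.

Lemma union_cells_bound B sigma Ts :
  2 < B -> size Ts < B -> size (flatten Ts) < B -> sigma <= B ->
  all (ltn^~ sigma) (flatten Ts) -> all (ltn^~ B) [:: 2, size Ts & words_cells Ts].
Proof.
move=> B2 count sizes sB /(all_ltn_leq sB) letters.
by rewrite /= B2 count words_cells_bound //; lia.
Qed.

Lemma string_cells_bound B sigma T :
  3 < B -> size T < B -> sigma <= B -> all (ltn^~ sigma) T ->
  all (ltn^~ B) (string_cells T).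
Proof.
move=> B3 sizeT sB /(all_ltn_leq sB) letters.
by rewrite /string_cells -cat1s all_cat word_cells_bound ?andbT /= ?B3 //; lia.
Qed.

(** * Boolean tests and nonempty intersections *)

Lemma unions_meet Ss Ts : has (mem Ss) Ts <->
  exists x, lang (Union (map rstring Ss)) x /\ lang (Union (map rstring Ts)) x.
Proof.
split=> [/hasP[x xT xS]|[x [/lang_union_rstring xS /lang_union_rstring xT]]].
  by exists x; split; apply/lang_union_rstring.
by apply/hasP; exists x.
Qed.

Lemma some_power_meet Us T : all (fun U => U != [::]) Us ->
  some_power Us T <->
  exists x, lang (Union (map rstring Us)) x /\ lang (Plus (rstring T)) x.
Proof.
move=> /allP U0; split=> [/hasP[U UUs /power_agree UT]|].
  exists U; split; first exact/lang_union_rstring.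
  by apply/lang_plus_rstring/UT/U0.
case=> x [/lang_union_rstring xUs /lang_plus_rstring xT].
by apply/hasP; exists x => //; apply/power_agree => //; apply: U0.
Qed.

Lemma common_power_meet S T : S != [::] -> T != [::] ->
  common_power S T <->
  exists x, lang (Plus (rstring S)) x /\ lang (Plus (rstring T)) x.
Proof.
move=> S0 T0; rewrite /common_power.
split=> [/(powers_meet_agree S0 T0)|] [x [xS xT]].
  by exists x; split; apply/lang_plus_rstring.
apply/(powers_meet_agree S0 T0); exists x.
by split; apply/lang_plus_rstring.
Qed.

Theorem theorem4 (t u : htype) :
  exists P : program,
  forall c : nat,
  exists C d : nat,
  forall (m n sigma w : nat) (A B : regexp),
    homogeneous t A -> rsize A = m ->
    homogeneous u B -> rsize B = n ->
    sigma <= (m + n) ^ c -> over_alphabet sigma A -> over_alphabet sigma B ->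
    (m + n) ^ d <= 2 ^ w ->
    exists2 b : bool,
      run w P (C * (m + n)) (init w (encode A ++ encode B)) = Some b &
      b <-> exists x : seq nat, lang A x /\ lang B x.
Proof.
exists (if (t, u) is (UnionConcat, UnionConcat) then trie_program else plus_program).
(* As [m] and [n] are positive, 50 covers the costliest bound, 38m + 17 for a union followed by a
   power; the exponent is that of [slot_bound]. *)
move=> c; exists 50, (2 * c + 11) => m n sigma w A B; rewrite /rsize /over_alphabet.
case: t => [[Ss [Ss_neq Ss0 ->]]|[S S_neq ->]] <-;
  case: u => [[Ts [Ts_neq Ts0 ->]]|[T T_neq ->]] <-;
  rewrite ?encode_union ?leaves_union ?[leaves _]leaves_rstring
    -?[encode (Plus _)]/(3 :: encode (rstring _)) ?encode_rstring
    -?/(string_cells _) => sN sA sB Nw.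
- have [Ss1 A0 Scount Scells] := union_sizes Ss_neq Ss0.
  have [Ts1 B0 Tcount Tcells] := union_sizes Ts_neq Ts0.
  set input := _ ++ _.
  have sizeE : size input = size (words_cells Ss) + size (words_cells Ts) + 4.
    by rewrite size_cat /=; lia.
  have [||sE Ew sw] := @word_bounds c _ sigma w (size input) _ sN _ Nw; [lia|lia|].
  exists (has (mem Ss) Ts); last exact: unions_meet.
  apply: run_init (fun M => run_union_union Ss1 Ts1 sA sB sE).
    by rewrite all_cat !(@union_cells_bound _ sigma) //; lia.
  by have := sum_sizes_leq 15 10 Ss1; have := sum_sizes_leq 15 11 Ts1; lia.
- have [Ss1 A0 Scount Scells] := union_sizes Ss_neq Ss0.
  have T0 : 0 < size T by rewrite lt0n size_eq0.
  set input := _ ++ _.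
  have sizeE : size input = size (words_cells Ss) + 2 * size T + 5.
    by rewrite size_cat /= size_letter_cells; lia.
  have [||_ Ew sw] := @word_bounds c _ sigma w (size input) _ sN _ Nw; [lia|lia|].
  exists (some_power Ss T); last exact: some_power_meet.
  apply: run_init (fun M HM => run_union_plus T0 Ss1 (fun i _ => HM i) Ew).
    rewrite all_cat (@union_cells_bound _ sigma) ?(@string_cells_bound _ sigma) //; lia.
  by have := sum_sizes_leq 15 15 Ss1; lia.
- have [Ts1 B0 Tcount Tcells] := union_sizes Ts_neq Ts0.
  have S0 : 0 < size S by rewrite lt0n size_eq0.
  set input := _ ++ _.
  have sizeE : size input = 2 * size S + size (words_cells Ts) + 5.
    by rewrite size_cat /= size_letter_cells; lia.
  have [||_ Ew sw] := @word_bounds c _ sigma w (size input) _ sN _ Nw; [lia|lia|].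
  exists (some_power Ts S).
    apply: run_init (fun M HM => run_plus_union S0 Ts1 (fun i _ => HM i) Ew).
      rewrite all_cat (@union_cells_bound _ sigma) ?(@string_cells_bound _ sigma) //; lia.
    by have := sum_sizes_leq 15 15 Ts1; lia.
  apply: (iff_trans (some_power_meet S Ts0)).
  by split=> -[x [? ?]]; exists x.
- have S0 : 0 < size S by rewrite lt0n size_eq0.
  have T0 : 0 < size T by rewrite lt0n size_eq0.
  set input := _ ++ _.
  have sizeE : size input = 2 * size S + 2 * size T + 6.
    by rewrite size_cat /= !size_letter_cells; lia.
  have [||_ Ew sw] := @word_bounds c _ sigma w (size input) _ sN _ Nw; [lia|lia|].
  (* The program loads the word of the second expression as its first operand, hence the exchanged
     arguments. *)
  exists (common_power T S).
    apply: run_init (fun M HM => run_plus_plus S0 T0 (fun i _ => HM i) Ew); last by lia.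
    by rewrite all_cat !(@string_cells_bound _ sigma) //; lia.
  apply: (iff_trans (common_power_meet T_neq S_neq)).
  by split=> -[x [? ?]]; exists x.
Qed.
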